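(* Let $h\ge 1$ be an integer and let $G=(V,E)$ be a directed graph with non-negative edge weights whose underlying undirected graph is $K_h$-minor-free. Let $S=\langle s_0,s_1,\ldots,s_{k-1}\rangle$ be any sequence of vertices of $G$ and let $M\subseteq\mathbb{R}$ be any set of real numbers. For each $v\in V$ define $$\overrightarrow{X}_v=\{(i,\Delta): 1\le i\le k-1,\ \Delta\in M,\ d_G(v\rightarrow s_i)-d_G(v\rightarrow s_0)\le \Delta\},$$ and let $\overrightarrow{\mathcal{LP}}_{G,M}(S)=\{\overrightarrow{X}_v: v\in V\}$, a family of subsets of the ground set $\{1,\ldots,k-1\}\times M$. Then $\overrightarrow{\mathcal{LP}}_{G,M}(S)$ has VC-dimension at most $h^2$.
   Context: $d_G(u\rightarrow v)$ denotes the length of a shortest directed path from $u$ to $v$ in $G$. For a family $\mathcal{F}$ of subsets of a ground set $U$, a set $Y\subseteq U$ is shattered by $\mathcal{F}$ if $\{Y\cap F: F\in\mathcal{F}\}=2^Y$; the VC-dimension of $\mathcal{F}$ is the maximum size of a shattered set. *)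

(* Defs.v *)
From HB Require Import structures.
From mathcomp Require Import all_boot all_order all_algebra.
From mathcomp Require Import boolp classical_sets functions cardinality.
From mathcomp Require Import reals ereal.

Set Implicit Arguments.
Unset Strict Implicit.
Unset Printing Implicit Defensive.

Import Order.TTheory GRing.Theory Num.Theory.

Local Open Scope classical_set_scope.
Local Open Scope ring_scope.

Definition connected_in (V : finType) (e : rel V) (B : {set V}) : Prop :=
  forall x y, x \in B -> y \in B ->
    connect [rel a b | [&& a \in B, b \in B & e a b]] x y.

(* [B] is a minor model: [B x] is the branch set contracted to the vertex [x]. *)
Definition is_minor (W : finType) (f : rel W) (V : finType) (e : rel V) : Prop :=
  exists B : W -> {set V},
    [/\ forall x, B x != finset.set0,
        forall x, connected_in e (B x),
        forall x y, x != y -> (B x :&: B y)%SET = finset.set0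
      & forall x y, f x y -> exists a b, [/\ a \in B x, b \in B y & e a b]].

Definition complete_graph (h : nat) : rel 'I_h := [rel i j | i != j].

Definition underlying (V : finType) (E : rel V) : rel V :=
  [rel u v | (u != v) && (E u v || E v u)].

Definition clique_minor_free (h : nat) (V : finType) (e : rel V) : Prop :=
  ~ is_minor (@complete_graph h) e.

(* Directed paths are represented as [u :: p], as in [path]. *)

Fixpoint path_length (R : realType) (V : finType) (w : V -> V -> R)
    (u : V) (p : seq V) : R :=
  if p is x :: q then w u x + path_length w x q else 0.

(* The infimum is over a finite set, hence a minimum, unless there is no
   directed path from [u] to [v], in which case the distance is [+oo]. *)
Definition dist (R : realType) (V : finType) (E : rel V) (w : V -> V -> R)
    (u v : V) : \bar R :=
  ereal_inf [set (path_length w u p)%:E |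
             p in [set p | [/\ path E u p, uniq (u :: p) & last u p = v]]].

Definition shattered (T : Type) (F : set (set T)) (Y : set T) : Prop :=
  [set Y `&` A | A in F] = [set Z | Z `<=` Y].

(* A bound on the cardinality of all shattered sets, so that in particular no
   infinite subset of the ground set [U] is shattered. *)
Definition VCdim_le (T : Type) (U : set T) (F : set (set T)) (d : nat) : Prop :=
  forall Y : set T, Y `<=` U -> shattered F Y -> (Y #<= `I_d)%card.

(* The sequence S is <s_0, ..., s_n>, of length k = n + 1 >= 1. *)

Definition LP_ground (R : realType) (n : nat) (M : set R) :
    set ('I_n.+1 * R) :=
  [set p : 'I_n.+1 * R | (1 <= p.1)%N /\ M p.2].

(* Subtraction in [\bar R] has [+oo - +oo = -oo], so the inequality is always
   equivalent to d(v -> s_i) <= d(v -> s_0) + Delta. *)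
Definition LP_set (R : realType) (V : finType) (E : rel V) (w : V -> V -> R)
    (n : nat) (S : n.+1.-tuple V) (M : set R) (v : V) : set ('I_n.+1 * R) :=
  [set p : 'I_n.+1 * R | [/\ (1 <= p.1)%N, M p.2 &
     (dist E w v (tnth S p.1) - dist E w v (tnth S ord0) <= p.2%:E)%E]].

Definition LP_family (R : realType) (V : finType) (E : rel V) (w : V -> V -> R)
    (n : nat) (S : n.+1.-tuple V) (M : set R) : set (set ('I_n.+1 * R)) :=
  [set LP_set E w S M v | v in [set: V]].

Lemma LP_sub_ground (R : realType) (V : finType) (E : rel V) (w : V -> V -> R)
    (n : nat) (S : n.+1.-tuple V) (M : set R) (v : V) :
  LP_set E w S M v `<=` LP_ground M.
Proof. by move=> p []. Qed.

(* Main.v *)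
Require Import Defs.
From HB Require Import structures.
From mathcomp Require Import all_boot all_order all_algebra.
From mathcomp Require Import boolp classical_sets functions cardinality.
From mathcomp Require Import reals ereal.
From mathcomp Require Import lra.

(** Given points [(i_1, Delta_1), ..., (i_h, Delta_h)] of a shattered set, give
    each vertex [x] to the index [a] that minimises
    [d(x -> s_(i_a)) - Delta_a], ties going to the least index.  A shortest
    path towards [s_(i_a)] never leaves the cell of [a] once it is in it, so the
    cells are connected.  A vertex [v] whose trace on the shattered set is
    [{a, b}] lies in the cell of [a] or of [b], and a shortest path from [v]
    to the other site meets no third cell, so the two cells are adjacent.  The
    cells thus form a [K_h] minor.  One further point of the shattered set is
    left out of all these traces, which makes [d(v -> s_0)] finite.  The
    VC-dimension is hence even at most [h]. *)

Set Implicit Arguments.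
Unset Strict Implicit.
Unset Printing Implicit Defensive.

Import Order.TTheory GRing.Theory Num.Theory.

Local Open Scope classical_set_scope.
Local Open Scope ring_scope.

(** The list grows one element at a time; a list of length [k <= d] that cannot grow enumerates [Y],
    which would bound its cardinality by [d]. This covers infinite [Y] too. *)
Lemma not_card_le_uniq_seq (T : choiceType) (Y : set T) (d : nat) :
  ~ (Y #<= `I_d)%card ->
  exists s : seq T, [/\ uniq s, size s = d.+1 & forall x, x \in s -> Y x].
Proof.
move=> Yd.
suff H k : (k <= d.+1)%N -> exists s : seq T,
    [/\ uniq s, size s = k & forall x, x \in s -> Y x] by exact: H.
elim: k => [|k IHk] kd; first by exists [::].
have [s [us sk sY]] := IHk (ltnW kd).
have [[x Yx xs]|Ns] := pselect (exists2 x, Y x & x \notin s).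
  exists (x :: s); split; rewrite /= ?xs ?sk// => y.
  by rewrite in_cons => /orP[/eqP->|/sY].
exfalso; apply: Yd.
have {}Ns x : Y x -> x \in s.
  by move=> Yx; apply: contrapT => /negP xs; apply: Ns; exists x.
have kId : (`I_k #<= `I_d)%card by rewrite card_le_II.
apply: card_le_trans kId.
case: s us sk sY Ns => [|x0 s] us sk sY Ns.
  by rewrite (_ : Y = set0) ?card_le0l// -subset0 => x /Ns.
apply: card_le_trans (card_image_le (nth x0 (x0 :: s)) _).
apply: subset_card_le => x /Ns xs; exists (index x (x0 :: s)).
  by rewrite /mkset -sk index_mem.
by rewrite nth_index.
Qed.

(** * Shortest directed paths *)

Section Distance.
Context (R : realType) (V : finType) (E : rel V) (w : V -> V -> R).
Hypothesis w_ge0 : forall u v : V, E u v -> 0 <= w u v.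

Local Notation d := (dist E w).

Lemma path_length_ge0 x p : path E x p -> 0 <= path_length w x p.
Proof.
elim: p x => //= y p IHp x /andP[xy yp].
by rewrite addr_ge0 ?w_ge0 ?IHp.
Qed.

Lemma path_length_cat x p q :
  path_length w x (p ++ q) = path_length w x p + path_length w (last x p) q.
Proof. by elim: p x => [|y p IHp] x /=; rewrite ?add0r// IHp addrA. Qed.

Lemma dist_le x z p : path E x p -> uniq (x :: p) -> last x p = z ->
  (d x z <= (path_length w x p)%:E)%E.
Proof. by move=> xp up pz; apply: ereal_inf_lbound; exists p. Qed.

Definition geodesic x z p :=
  [/\ path E x p, uniq (x :: p), last x p = z & d x z = (path_length w x p)%:E].

Lemma geodesic_exists x z : (d x z < +oo)%E -> exists p, geodesic x z p.
Proof.
move=> dlt.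
have [p0 [xp0 up0 p0z]] :
    exists p, [/\ path E x p, uniq (x :: p) & last x p = z].
  apply: contrapT => Np; move: dlt; rewrite /dist (_ : [set p | _] = set0).
    by rewrite image_set0 ereal_inf0.
  by rewrite -subset0 => p Pp; apply: Np; exists p.
(* Simple paths have bounded length, so they live in the finite type [#|V|.-bseq V], where a minimum
   is attained. *)
have sz p : uniq (x :: p) -> (size p <= #|V|)%N.
  by move=> /card_uniqP /= szp; rewrite ltnW// -szp max_card.
pose P (p : #|V|.-bseq V) := [&& path E x p, uniq (x :: p) & last x p == z].
have P0 : P (Bseq (sz _ up0)) by rewrite /P /= xp0 p0z eqxx andbT.
pose len (p : #|V|.-bseq V) := path_length w x p.
case: (Order.TotalTheory.arg_minP len P0) => p /and3P[xp up /eqP pz] minp.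
exists p; split => //; apply/eqP; rewrite eq_le dist_le//=.
apply: le_ereal_inf_tmp => _ [q [xq uq qz] <-]; rewrite lee_fin.
by apply: (minp (Bseq (sz _ uq))); rewrite /P /= xq qz eqxx andbT.
Qed.

Lemma dist_edge x y z : E x y -> (d x z <= (w x y)%:E + d y z)%E.
Proof.
move=> xy; have [->|yz] := eqVneq (d y z) +oo%E; first by rewrite addey// leey.
have [p [yp up pz ->]] : exists p, geodesic y z p.
  by apply: geodesic_exists; rewrite ltey.
(* [dist] ranges over simple paths only, so [x] cannot be prepended to a geodesic through [x]; in
   that case its part after [x] is used, which is no longer because weights are non-negative. *)
have [xp|xp] := boolP (x \in y :: p); last first.
  by rewrite -EFinD; apply: (@dist_le x z (y :: p)); rewrite //= ?xy// xp.
case/splitPl: xp yp up pz => p1 p2 xE; rewrite cat_path last_cat xE.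
move=> /andP[yp1 xp2] up p2z.
apply: (@le_trans _ _ (path_length w x p2)%:E).
  apply: dist_le => //; move: up.
  by rewrite -cat_cons lastI xE cat_rcons cat_uniq => /and3P[].
rewrite -EFinD lee_fin path_length_cat xE addrA lerDr.
by rewrite addr_ge0 ?w_ge0 ?path_length_ge0.
Qed.

Lemma geodesic_behead x z y p : geodesic x z (y :: p) ->
  [/\ E x y, geodesic y z p & d x z = ((w x y)%:E + d y z)%E].
Proof.
move=> [/= /andP[xy yp] /andP[xyp up] pz dE].
have dy : d y z = (path_length w y p)%:E.
  apply/eqP; rewrite eq_le dist_le//=.
  by have := dist_edge z xy; rewrite dE EFinD leeD2lE.
by rewrite dE dy.
Qed.

Lemma geodesic_underlying x z y p :
  geodesic x z (y :: p) -> underlying E x y.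
Proof.
move=> [/= /andP[xy _] + _ _]; rewrite inE negb_or => /andP[/andP[nxy _] _].
by rewrite /underlying /= nxy xy.
Qed.

Lemma geodesic_lty x z p : geodesic x z p -> (d x z < +oo)%E.
Proof. by move=> [_ _ _ ->]; rewrite ltry. Qed.

End Distance.

(** * Additively weighted Voronoi cells *)

Section Voronoi.
Context (R : realType) (V : finType) (E : rel V) (w : V -> V -> R).
Hypothesis w_ge0 : forall u v : V, E u v -> 0 <= w u v.
Context (h : nat) (s : 'I_h -> V) (D : 'I_h -> R).

Local Notation d := (dist E w).
Local Notation geodesic := (geodesic E w).

Definition phi (i : 'I_h) (x : V) : \bar R := (d x (s i) - (D i)%:E)%E.

Definition owns (i : 'I_h) (x : V) : bool :=
  [forall k, (phi i x <= phi k x)%E && ((k < i)%N ==> (phi i x < phi k x)%E)].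

Lemma ownsP i x :
  reflect (forall k, (phi i x <= phi k x)%E /\
                     ((k < i)%N -> (phi i x < phi k x)%E))
          (owns i x).
Proof.
apply: (iffP forallP) => H k; first by have /andP[? /implyP] := H k.
by have [? ?] := H k; apply/andP; split => //; apply/implyP.
Qed.

Lemma owns_uniq i j x : owns i x -> owns j x -> i = j.
Proof.
move=> /ownsP oi /ownsP oj; have [lt|lt|/val_inj//] := ltngtP i j.
  by have := (oj i).2 lt; rewrite ltNge (oi j).1.
by have := (oi j).2 lt; rewrite ltNge (oj i).1.
Qed.

Lemma owns_exists (i : 'I_h) x : exists k, owns k x.
Proof.
case: (@Order.TotalTheory.arg_minP _ _ _ i xpredT (phi^~ x) isT) => m _ minm.
have Pm : [pred a | [forall k, (phi a x <= phi k x)%E]] m.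
  by apply/forallP => k; exact: minm.
case: (arg_minnP (@nat_of_ord h) Pm) => a /forallP mina lea.
exists a; apply/ownsP => k; split => // ka; rewrite lt_neqAle mina andbT.
(* Equality would make [k] a minimiser of [phi] as well, and [a] is the least one. *)
apply: contraTneq ka => ake; rewrite -leqNgt lea//=.
by apply/forallP => l; rewrite -ake.
Qed.

(* Along an edge of a shortest path to [s i], [phi i] drops by the weight of the
   edge, and any other [phi k] by at most that much. *)
Lemma phi_geodesic i k x y p : geodesic x (s i) (y :: p) ->
  ((phi i x <= phi k x)%E -> (phi i y <= phi k y)%E) /\
  ((phi i x < phi k x)%E -> (phi i y < phi k y)%E).
Proof.
move=> /(geodesic_behead w_ge0)[xy [_ _ _ dy] dx].
have := dist_edge w_ge0 (s k) xy.
rewrite /phi dx dy.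
case: (d x (s k)) (d y (s k)) => [a| |] [b| |] //=;
  rewrite -?EFinD ?lee_fin ?lte_fin ?leey ?leNye ?ltry ?ltNyr ?EFinN //.
by move=> ?; split; lra.
Qed.

(** Both the weak and the strict inequalities survive the step, so the tie-breaking does too. *)
Lemma owns_geodesic i x y p : geodesic x (s i) (y :: p) -> owns i x -> owns i y.
Proof.
move=> g /ownsP oi; apply/ownsP => k; have [le lt] := phi_geodesic k g.
by have [? H] := oi k; split; [exact: le|move=> /H /lt].
Qed.

(** A vertex that reaches no site also has an owner, by tie-breaking among values [+oo]; the
    finiteness condition discards it. *)
Definition cell i : {set V} := [set x | owns i x && (d x (s i) < +oo)%E]%SET.

Let cell_rel i := [rel a b | [&& a \in cell i, b \in cell i & underlying E a b]].

Lemma cell_connect_site i x : x \in cell i ->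
  (s i \in cell i) && connect (cell_rel i) x (s i).
Proof.
rewrite inE => /andP[oi /geodesic_exists[p]].
elim: p x oi => [|y p IHp] x oi g.
  by have [_ _ /= <- _] := g; rewrite connect0 inE oi (geodesic_lty g).
have oy := owns_geodesic g oi.
have [_ gy _] := geodesic_behead w_ge0 g.
have /andP[-> ys] := IHp y oy gy.
apply: connect_trans ys; apply: connect1.
rewrite /= !inE oi oy (geodesic_lty g) (geodesic_lty gy).
exact: geodesic_underlying g.
Qed.

Lemma underlying_sym : symmetric (underlying E).
Proof. by move=> x y; rewrite /underlying /= eq_sym orbC. Qed.

Lemma cell_rel_sym i : connect_sym (cell_rel i).
Proof. by apply: sym_connect_sym => x y; rewrite /= underlying_sym andbCA. Qed.

Lemma cell_connected i : connected_in (underlying E) (cell i).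
Proof.
move=> x y /cell_connect_site/andP[_ xs] /cell_connect_site/andP[_ ys].
by apply: connect_trans xs _; rewrite cell_rel_sym.
Qed.

(** Follow a geodesic from [v] to [s j]: [phi j] stays below every third [phi k], so the first
    vertex outside cell [i] is in cell [j]. *)
Lemma cell_adjacent i j v : i != j -> v \in cell i -> s j \in cell j ->
  (d v (s j) < +oo)%E ->
  (forall k, k != i -> k != j -> (phi j v < phi k v)%E) ->
  exists a b, [/\ a \in cell i, b \in cell j & underlying E a b].
Proof.
move=> ij + sj /geodesic_exists[p].
elim: p v => [|y p IHp] v vi gv ltk.
  have [_ _ /= vE _] := gv.
  move: vi sj; rewrite vE !inE => /andP[oi _] /andP[oj _].
  by move: ij; rewrite (owns_uniq oi oj) eqxx.
have [_ gy _] := geodesic_behead w_ge0 gv.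
have ltky k : k != i -> k != j -> (phi j y < phi k y)%E.
  by move=> ki kj; apply: (phi_geodesic k gv).2; exact: ltk.
have [k ok] := owns_exists i y.
(* The owner's value is at most [phi j y], finite since [y] reaches [s j]. *)
have phiy : (phi k y < +oo)%E.
  have /ownsP/(_ j)[/le_lt_trans + _] := ok; apply.
  by have [_ _ _ dy] := gy; rewrite /phi dy -EFinB ltry.
have yk : y \in cell k.
  rewrite inE ok /=; move: phiy.
  by rewrite /phi; case: (d y (s k)) => [r| |] //; rewrite ?ltry ?ltNyr.
have [ki|ki] := eqVneq k i; first by apply: (IHp y) => //; rewrite -ki.
have [kj|kj] := eqVneq k j; last first.
  by have /ownsP/(_ j)[+ _] := ok; rewrite leNgt ltky.
by exists v, y; rewrite -kj; split => //; exact: geodesic_underlying gv.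
Qed.

Lemma voronoi_clique_minor :
  (forall i j, exists v, [/\ (d v (s i) < +oo)%E, (d v (s j) < +oo)%E &
     forall k, k != i -> k != j ->
       (phi i v < phi k v)%E /\ (phi j v < phi k v)%E]) ->
  is_minor (@complete_graph h) (underlying E).
Proof.
move=> sep.
have owner i j v :
    (forall k, k != i -> k != j ->
       (phi i v < phi k v)%E /\ (phi j v < phi k v)%E) ->
    owns i v \/ owns j v.
  move=> ltk; have [k ok] := owns_exists i v.
  have [<-|ki] := eqVneq k i; first by left.
  have [<-|kj] := eqVneq k j; first by right.
  by have /ownsP/(_ i)[+ _] := ok; rewrite leNgt (ltk k ki kj).1.
have cell_site i : s i \in cell i.
  (* The diagonal case of [sep] makes cell [i] nonempty, hence it contains its site. *)
  have [v [dv _ ltk]] := sep i i.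
  have /cell_connect_site/andP[] // : v \in cell i.
  by rewrite inE dv andbT; case: (owner _ _ _ ltk).
exists cell; split.
- by move=> i; apply/finset.set0Pn; exists (s i).
- exact: cell_connected.
- move=> i j ij; apply/finset.setP => x; rewrite !inE; apply/negP.
  move=> /andP[/andP[oi _] /andP[oj _]].
  by move: ij; rewrite (owns_uniq oi oj) eqxx.
- move=> i j; rewrite /= => ij; have [v [dvi dvj ltk]] := sep i j.
  have [oi|oj] := owner _ _ _ ltk.
    apply: (@cell_adjacent i j v) => //; first by rewrite inE oi.
    by move=> k ki kj; have [] := ltk k ki kj.
  have [|||||a [b [aj bi ab]]] := @cell_adjacent j i v => //.
  + by rewrite eq_sym.
  + by rewrite inE oj.
  + by move=> k kj ki; have [] := ltk k ki kj.
  by exists b, a; rewrite underlying_sym.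
Qed.

End Voronoi.

(** Among [h + 1] shattered points, those of index below [h] give the sites and weights. For a
    vertex [v] with trace [{p i, p j}], the number [d(v -> s_0)] separates [phi i v] and [phi j v]
    from all other [phi k v]. *)
Lemma LP_VCdim_le (R : realType) (h : nat) (V : finType) (E : rel V)
    (w : V -> V -> R) (w_ge0 : forall u v : V, E u v -> 0 <= w u v)
    (minor_free : clique_minor_free h (underlying E))
    (n : nat) (S : n.+1.-tuple V) (M : set R) :
  VCdim_le (LP_ground M) (LP_family E w S M) h.
Proof.
move=> Y YU shY; apply: contrapT => /not_card_le_uniq_seq[t [ut szt tY]].
have x0 : 'I_n.+1 * R := (ord0, 0).
pose p k := nth x0 t k.
have pY k : (k < h.+1)%N -> Y (p k).
  by move=> kh; apply: tY; rewrite mem_nth// szt.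
have pinj k l : (k < h.+1)%N -> (l < h.+1)%N -> p k = p l -> k = l.
  by move=> kh lh /eqP; rewrite nth_uniq ?szt// => /eqP.
apply: minor_free.
apply: (@voronoi_clique_minor R V E w w_ge0 h (fun i => tnth S (p i).1)
  (fun i => (p i).2)) => i j.
have ltS (k : 'I_h) : (k < h.+1)%N := ltnW (ltn_ord k).
have : [set Z | Z `<=` Y] [set p i; p j].
  by move=> x [] ->; apply: pY.
rewrite -shY => -[_ [v _ <-]] trE.
have trP k : (k < h.+1)%N ->
    (dist E w v (tnth S (p k).1) - dist E w v (tnth S ord0) <= (p k).2%:E)%E =
    (k == i) || (k == j).
  move=> kh; apply/idP/idP => [le|ij].
    have : [set p i; p j] (p k).
      by rewrite -trE; split; [exact: pY|have [? ?] := YU _ (pY k kh); split].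
    by case=> /pinj ->; rewrite ?eqxx ?orbT.
  have : [set p i; p j] (p k) by case/orP: ij => /eqP ->; [left|right].
  by rewrite -trE => -[_ []].
(* The point [p h] is outside the trace as [i, j < h]. Were this distance [+oo], the difference
   would be [-oo] and [p h] would be in the trace. *)
have d0 : dist E w v (tnth S ord0) \is a fin_num.
  have := trP h (ltnSn h); rewrite !gtn_eqF ?ltn_ord//.
  have [->|] := eqVneq (dist E w v (tnth S ord0)) +oo%E.
    by case: (dist E w v _) => [r| |]; rewrite leNye.
  by rewrite -ltey => /geodesic_exists[q [_ _ _ ->]].
move: d0 trP; case: (dist E w v (tnth S ord0)) => // r _ trP.
have le_phi k : (k < h.+1)%N ->
    (dist E w v (tnth S (p k).1) - (p k).2%:E <= r%:E)%E = (k == i) || (k == j).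
  by move=> kh; rewrite -trP// !leeBlDr// addeC.
(* With [r] finite, an infinite distance to the site would violate the inequality that puts [p i],
   or [p j], in the trace. *)
exists v; split.
- have := trP i (ltS i); rewrite eqxx /=.
  by case: (dist E w v _) => [a| |] //; rewrite ltry.
- have := trP j (ltS j); rewrite eqxx orbT /=.
  by case: (dist E w v _) => [a| |] //; rewrite ltry.
move=> k ki kj; rewrite /phi.
have rk : (r%:E < dist E w v (tnth S (p k).1) - (p k).2%:E)%E.
  by rewrite ltNge le_phi ?ltS// negb_or ki kj.
by split; apply: le_lt_trans rk; rewrite le_phi ?ltS// eqxx ?orbT.
Qed.

Theorem theorem1p4 (R : realType) (h : nat) (h_ge1 : (1 <= h)%N)
    (V : finType) (E : rel V) (w : V -> V -> R)
    (w_ge0 : forall u v : V, E u v -> 0 <= w u v)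
    (minor_free : clique_minor_free h (underlying E))
    (n : nat) (S : n.+1.-tuple V) (M : set R) :
  VCdim_le (LP_ground M) (LP_family E w S M) (h ^ 2)%N.
Proof.
move=> Y YU shY.
apply: card_le_trans (LP_VCdim_le w_ge0 minor_free YU shY) _.
by rewrite card_le_II -{1}(expn1 h) leq_pexp2l.
Qed.
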